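(* The function $f$ maps $]0,\infty[$ into $]0,\infty[$ and has the properties (i) $f(1)=1$; (ii) $\log(1/f)$ is convex on $]0,\infty[$; (iii) $f(s)=f(s+1)-1/f(s+1)$ for all $s>0$. Conversely, if $\tilde f:]0,\infty[\to]0,\infty[$ satisfies (i)–(iii) (with $f$ replaced by $\tilde f$), then $\tilde f=f$ on $]0,\infty[$, and for $0<s\le1$ $$\tilde f(s)=\lim_{n\to\infty}\psi^{\circ n}\!\left(\frac{1}{m_{n-1}}\left(\frac{m_{n-1}}{m_n}\right)^{s}\right),$$ where $\psi(z)=z-1/z$ and $\psi^{\circ n}$ denotes the $n$-fold composition. In particular this limit formula holds for $f$.
   Context: Let $(m_n)_{n\ge0}$ be the unique sequence of positive reals with $m_0=1$ and $(1+m_1+\cdots+m_n)\,m_n=1$ for $n\ge1$. It is a Hausdorff moment sequence: let $\mu$ be the unique probability measure on $[0,1]$ with $\int_0^1 t^n\,d\mu(t)=m_n$ for all $n\ge0$. For real $s>0$ let $f(s)=\int_0^1\frac{1-t^s}{1-t}\,d\mu(t)$ (integrand equal to $s$ at $t=1$ and to $1$ at $t=0$). *)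

(* Defs.v *)
From HB Require Import structures.
From mathcomp Require Import all_boot all_order all_algebra.
From mathcomp Require Import all_classical all_reals all_analysis.
Set Implicit Arguments. Unset Strict Implicit. Unset Printing Implicit Defensive.
Import Order.TTheory GRing.Theory Num.Theory.
Import numFieldNormedType.Exports.
Local Open Scope classical_set_scope.
Local Open Scope ring_scope.

(* integrand (1 - t^s)/(1 - t), equal to s at t = 1 (and to 1 at t = 0,
   automatically since 0 `^ s = 0 for s > 0) *)
Definition kernel_f (R : realType) (s t : R) : R :=
  if t == 1 then s else (1 - powR t s) / (1 - t).

Definition f_mu (R : realType) (mu : probability R R) (s : R) : R :=
  Rintegral mu `[0, 1]%classic (kernel_f s).

Definition psi (R : realType) (z : R) : R := z - 1 / z.

(* Main.v *)
(* Put [x_n = 1 / m_n], so that [f (n + 1) = x_n] and [x_n = psi x_(n+1)].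

   Since [s |-> (1 - t^s) / (1 - t)] is concave, [f] is concave, hence log-concave.

   The functional equation amounts to [\int t^s dmu = 1 / f (s + 1)], which holds at
   integers. The operator [A v x = \int (v x - t v (t x)) / (1 - t) dmu t] multiplies
   [t^s] by [f (s + 1)] and obeys a maximum principle, so its inverse is positive on
   linear combinations of powers. Thus [t^s |-> 1 / f (s + 1)] extends to a positive
   functional which agrees with [mu] on polynomials, hence on every [t^s] by uniform
   approximation.

   For the limit, log-concavity traps [g (n + s)], for any [g] satisfying (i)-(iii),
   between [x_(n-1) (x_n / x_(n-1))^s] and [x_(n-1) (x_(n-1) / x_(n-2))^s]. This gap is
   [O(1 / x_n^2)], while [n] iterations of [psi], which send [g (n + s)] to [g s],
   stretch it by at most [2 x_(n-1)]; and [x_n] tends to infinity. *)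

Require Import Defs.
From HB Require Import structures.
From mathcomp Require Import all_boot all_order all_algebra.
From mathcomp Require Import all_classical all_reals all_analysis.
From mathcomp Require Import measurable_realfun ring lra.
Import Order.TTheory GRing.Theory Num.Theory.
Import numFieldNormedType.Exports.
Local Open Scope classical_set_scope.
Local Open Scope ring_scope.

Set Implicit Arguments.
Unset Strict Implicit.
Unset Printing Implicit Defensive.

(** * Uniform polynomial approximation of real powers on [0, 1] *)

Lemma subrX_le (R : realDomainType) (u v : R) (n : nat) :
  0 <= v -> v <= u -> u <= 1 -> u ^+ n - v ^+ n <= n%:R * (u - v).
Proof.
move=> v0 vu u1; elim: n => [|n IH]; first by rewrite !expr0 subrr mul0r.
have -> : u ^+ n.+1 - v ^+ n.+1 = u * (u ^+ n - v ^+ n) + v ^+ n * (u - v).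
  by rewrite !exprS; ring.
rewrite -natr1 mulrDl mul1r lerD//.
  apply: le_trans IH; rewrite ler_piMl// subr_ge0 lerXn2r ?nnegrE//.
  exact: le_trans vu.
by rewrite ler_piMl ?subr_ge0// exprn_ile1// (le_trans vu).
Qed.

Lemma ger1_powR0 (R : realType) (y r : R) : 0 <= y <= 1 -> 0 <= r <= 1 -> y <= y `^ r.
Proof.
move=> /andP[y0 y1] /andP[r0 r1]; have [->|yN0] := eqVneq y 0; first exact: powR_ge0.
by rewrite ger1_powR// lt_neqAle eq_sym yN0 y0.
Qed.

Lemma powR_le1 (R : realType) (x r : R) : 0 <= x <= 1 -> 0 <= r -> x `^ r <= 1.
Proof.
move=> /andP[x0 x1] r0; have := ge0_ler_powR r0.
by move=> /(_ x 1); rewrite !nnegrE powR1; apply.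
Qed.

(** After division by a^r, with y = b / a, this reads 1 <= y^r + (1 - y)^r, which holds because each
    power dominates its base. *)
Lemma powR_sub_le (R : realType) (r a b : R) : 0 <= r <= 1 -> 0 <= b -> b <= a ->
  a `^ r - b `^ r <= (a - b) `^ r.
Proof.
move=> r01 b0 ba; have a0 := le_trans b0 ba.
have [a0'|aN0] := eqVneq a 0.
  have -> : b = a by apply/eqP; rewrite eq_le ba a0' b0.
  by rewrite subrr powR_ge0.
have ap : 0 < a by rewrite lt_neqAle eq_sym aN0.
have y0 : 0 <= b / a by rewrite divr_ge0.
have y1 : b / a <= 1 by rewrite ler_pdivrMr// mul1r.
have -> : b = a * (b / a) by rewrite mulrCA divff// mulr1.
have -> : a - a * (b / a) = a * (1 - b / a) by ring.
have y1' : 0 <= 1 - b / a by rewrite subr_ge0.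
rewrite (powRM r a0 y0) (powRM r a0 y1').
rewrite -{1}[a `^ r]mulr1 -mulrBr ler_wpM2l ?powR_ge0// lerBlDr.
rewrite -{1}(subrK (b / a) 1).
by apply: lerD; apply: ger1_powR0 => //; rewrite ?y0 ?subr_ge0 ?y1 ?gerBl.
Qed.

(* Writing [s = n r] with [0 <= r <= 1] reduces the modulus of continuity of [x ^ s]
   to the subadditivity of [x ^ r]. *)
Lemma powR_modulus (R : realType) (s e : R) : 0 <= s -> 0 < e ->
  exists2 K, 0 <= K & forall a b, 0 <= a <= 1 -> 0 <= b <= 1 ->
    `|a `^ s - b `^ s| <= e + K * (a - b) ^+ 2.
Proof.
rewrite le_eqVlt => /predU1P[<- e0|s0 e0].
  by exists 0 => // a b _ _; rewrite !powRr0 subrr normr0 mul0r addr0 ltW.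
set n := (Num.Def.trunc s).+1; set r := s / n%:R.
have n0 : 0 < n%:R :> R by rewrite ltr0n.
have r0 : 0 < r by rewrite divr_gt0.
have r1 : r <= 1 by rewrite ler_pdivrMr// mul1r ltW// truncnS_gt.
have sE : s = r * n%:R by rewrite divfK ?gt_eqF.
clearbody r.
(* [d] solves n d^r = e, so the term [e] covers the case a - b <= d. Beyond it (a - b)^2 / d^2 >= 1,
   and the crude bound [n] suffices. *)
set d := (e / n%:R) `^ r^-1.
have d0 : 0 < d by rewrite powR_gt0// divr_gt0.
have dr : d `^ r = e / n%:R.
  by rewrite -powRrM mulVf ?gt_eqF// powRr1// ltW// divr_gt0.
exists (n%:R / d ^+ 2); first by rewrite divr_ge0// ?exprn_ge0// ltW.
suff H a b : 0 <= b -> b <= a -> a <= 1 ->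
    `|a `^ s - b `^ s| <= e + n%:R / d ^+ 2 * (a - b) ^+ 2.
  move=> a b /andP[a0 a1] /andP[b0 b1].
  have [ba|/ltW ab] := leP b a; first exact: H.
  by rewrite distrC -(opprB b) sqrrN; apply: H.
move=> b0 ba a1; have a0 := le_trans b0 ba.
have bra : b `^ r <= a `^ r by rewrite ge0_ler_powR ?nnegrE// ltW.
rewrite sE !powRrM !powR_mulrn ?powR_ge0//.
rewrite ger0_norm ?subr_ge0; last by rewrite lerXn2r ?nnegrE ?powR_ge0//.
have ar1 : a `^ r <= 1.
  by apply: powR_le1; [rewrite a0|exact: ltW].
apply: le_trans (subrX_le n (powR_ge0 b r) bra ar1) _.
have h : a `^ r - b `^ r <= (a - b) `^ r.
  by apply: powR_sub_le => //; rewrite ltW.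
apply: (le_trans (ler_wpM2l (ltW n0) h)).
have ab0 : 0 <= a - b by rewrite subr_ge0.
have [abd|dab] := leP (a - b) d.
  apply: (@le_trans _ _ (n%:R * d `^ r)).
    by rewrite ler_wpM2l ?(ltW n0)// ge0_ler_powR ?nnegrE// ltW.
  rewrite dr mulrCA divff ?gt_eqF// mulr1 lerDl.
  by rewrite mulr_ge0 ?sqr_ge0// divr_ge0 ?exprn_ge0// ltW.
apply: (@le_trans _ _ n%:R).
  rewrite ler_piMr ?(ltW n0)// powR_le1 ?(ltW r0)// ab0/=.
  by lra.
rewrite -[leLHS]add0r lerD// ?(ltW e0)// -mulrA ler_peMr ?(ltW n0)//.
by rewrite mulrC ler_pdivlMr ?exprn_gt0// mul1r lterXn2r// ?nnegrE ltW.
Qed.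

(* [bernstein_poly N phi] is the usual [\sum_k 'C(N, k) phi k 'X^k (1 - 'X)^(N - k)]. *)
Fixpoint bernstein_poly (R : comNzRingType) (N : nat) (phi : nat -> R) : {poly R} :=
  if N is N'.+1 then
    'X * bernstein_poly N' (fun k => phi k.+1) + (1 - 'X) * bernstein_poly N' phi
  else (phi 0%N)%:P.

(* The last term is the variance [N t (1 - t)] of a binomial variable, plus the
   square of the shift [x] that the induction on [N] produces. *)
Lemma bernstein_poly_dist (R : realDomainType) (e K t : R) (N : nat)
    (phi : nat -> R) (c x : R) : 0 <= t <= 1 ->
  (forall k, (k <= N)%N -> `|phi k - c| <= e + K * (k%:R + x - N%:R * t) ^+ 2) ->
  `|(bernstein_poly N phi).[t] - c| <= e + K * (N%:R * t * (1 - t) + x ^+ 2).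
Proof.
move=> /andP[t0 t1]; elim: N phi x => [|N IH] phi x H /=.
  by have := H 0%N isT; rewrite hornerC !mul0r subr0 !add0r.
rewrite !hornerE.
set p := (bernstein_poly N _).[t]; set q := (bernstein_poly N phi).[t].
have Hp : `|p - c| <= e + K * (N%:R * t * (1 - t) + (x + 1 - t) ^+ 2).
  apply: IH => k kN; apply: (le_trans (H _ _)) => //.
  by rewrite -!natr1 (_ : _ - _ = k%:R + (x + 1 - t) - N%:R * t)//; ring.
have Hq : `|q - c| <= e + K * (N%:R * t * (1 - t) + (x - t) ^+ 2).
  apply: IH => k kN; apply: (le_trans (H _ _)); first exact: leqW.
  by rewrite -!natr1 (_ : _ - _ = k%:R + (x - t) - N%:R * t)//; ring.
have -> : t * p + (1 - t) * q - c = t * (p - c) + (1 - t) * (q - c) by ring.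
have t1' : 0 <= 1 - t by rewrite subr_ge0.
apply: (le_trans (ler_normD _ _)); rewrite !normrM (ger0_norm t0) (ger0_norm t1').
apply: (le_trans (lerD (ler_wpM2l t0 Hp) (ler_wpM2l t1' Hq))).
by rewrite le_eqVlt; apply/predU1P; left; rewrite -natr1; ring.
Qed.

(** Bernstein approximation at the nodes k / N: the modulus e / 2 + K (a - b)^2, scaled by [N], is
    the hypothesis of [bernstein_poly_dist] with zero shift, and the variance leaves the error K t
    (1 - t) / N. *)
Lemma powR_poly_approx (R : realType) (s e : R) : 0 <= s -> 0 < e ->
  exists p : {poly R}, forall t, 0 <= t <= 1 -> `|p.[t] - t `^ s| <= e.
Proof.
move=> s0 e0; have e20 : 0 < e / 2 by rewrite divr_gt0.
have [K K0 HK] := powR_modulus s0 e20.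
set N := (Num.Def.trunc (K / (e / 2))).+1.
have N0 : 0 < N%:R :> R by rewrite ltr0n.
have KN : K / N%:R <= e / 2.
  by rewrite ler_pdivrMr// mulrC -ler_pdivrMr// ltW// truncnS_gt.
exists (bernstein_poly N (fun k => (k%:R / N%:R) `^ s)) => t /andP[t0 t1].
have := @bernstein_poly_dist R (e / 2) (K / N%:R ^+ 2) t N
  (fun k => (k%:R / N%:R) `^ s) (t `^ s) 0.
rewrite t0 t1 => /(_ isT) H; apply: (le_trans (H _)) => {H}.
  move=> k kN; rewrite addr0.
  have -> : K / N%:R ^+ 2 * (k%:R - N%:R * t) ^+ 2 = K * (k%:R / N%:R - t) ^+ 2.
    by field; rewrite gt_eqF.
  apply: HK; rewrite ?t0//.
  by rewrite divr_ge0// ler_pdivrMr// mul1r ler_nat.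
rewrite [leRHS](splitr e) lerD2l expr0n/= addr0.
have -> : K / N%:R ^+ 2 * (N%:R * t * (1 - t)) = K / N%:R * (t * (1 - t)).
  by field; rewrite gt_eqF.
apply: le_trans KN; rewrite ler_piMr ?divr_ge0// ?ltW//.
by nra.
Qed.

Lemma within_continuous_powR (R : realType) (s : R) : 0 <= s ->
  {within `[0, 1], continuous (fun x : R => x `^ s)}.
Proof.
move=> s0; apply/subspace_continuousP => x; rewrite /= in_itv /= => x01.
apply/cvgrPdist_le => e e0.
have e20 : 0 < e / 2 by rewrite divr_gt0.
have [K K0 HK] := powR_modulus s0 e20.
have K1 : 0 < K + 1 by rewrite ltr_wpDl.
(* The cap at 1 bounds (x - y)^2 by |x - y|, and [K + 1] keeps the divisor positive when K = 0. *)
have d0 : 0 < Num.min 1 (e / 2 / (K + 1)) by rewrite lt_min ltr01 divr_gt0.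
have near_x : \forall y \near (x : R), `|(x : R) - y| <= Num.min 1 (e / 2 / (K + 1)).
  have := @cvgr_dist_le R R^o R (nbhs (x : R)) _ id (x : R).
  by move=> /(_ _ cvg_id _ d0).
near=> y => /=.
have y01 : 0 <= y <= 1 by near: y; exact: withinT.
apply: (le_trans (HK _ _ x01 y01)); rewrite [leRHS](splitr e) lerD2l.
have : `|x - y| <= Num.min 1 (e / 2 / (K + 1)).
  by near: y; apply: cvg_within; exact: near_x.
rewrite le_min => /andP[xy1 xy2]; rewrite -real_normK ?num_real//.
apply: (@le_trans _ _ ((K + 1) * `|x - y|)).
  by rewrite ler_pM ?sqr_ge0 ?lerDl// expr2 ler_piMl.
by rewrite mulrC -ler_pdivlMr.
Unshelve. all: by end_near.
Qed.

(** * Log-convexity with real weights, and injectivity of [psi] *)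

Lemma i01_exists (R : realType) (l : R) : 0 <= l <= 1 -> exists i : {i01 R}, i%:num = l.
Proof.
move=> l01.
have i01 : Itv.spec (@Itv.num_sem R) (Itv.Real `[0, 1]%Z) l.
  by rewrite /= /Itv.num_sem/= num_real in_itv/= l01.
by exists (Itv.mk i01).
Qed.

Lemma i01_comb_gt0 (R : realType) (l a b : R) : 0 <= l <= 1 -> 0 < a -> 0 < b ->
  0 < l * a + (1 - l) * b.
Proof.
by move=> /i01_exists[i <-] a0 b0; have := convR_gt0 i a0 b0; rewrite convRE.
Qed.

(** Since ln (1 / g) = - ln g, condition (ii) is log-concavity of [g]; real weights let it be
    applied at explicit points. *)
Lemma convex_ln_inv (R : realType) (g : R -> R) : (forall s, 0 < s -> 0 < g s) ->
  convex_function (E := R^o) `]0, +oo[%classic (fun s => ln (1 / g s)) <->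
  forall l a b, 0 <= l <= 1 -> 0 < a -> 0 < b ->
    l * ln (g a) + (1 - l) * ln (g b) <= ln (g (l * a + (1 - l) * b)).
Proof.
move=> g0; split=> H.
  move=> l a b l01 a0 b0; have := i01_comb_gt0 l01 a0 b0.
  have [i <-] := i01_exists l01 => ab0.
  have := H i a b; rewrite !inE/= !in_itv/= !andbT => /(_ a0 b0).
  rewrite !convRE/= /unstable.onem !div1r !lnV ?posrE ?g0//.
  by lra.
move=> l a b; rewrite !inE/= !in_itv/= !andbT => a0 b0.
have ab0 := convR_gt0 l a0 b0.
have := H l%:num a b; rewrite ge0 le1 => /(_ isT a0 b0).
rewrite !div1r !lnV ?posrE ?g0// !convRE /unstable.onem.
by lra.
Qed.

(** The images differ by (y - z) (1 + 1 / (y z)). Positivity matters: [psi] takes the same value at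
    z and at -1 / z. *)
Lemma psi_inj (R : realType) (y z : R) : 0 < y -> 0 < z -> psi y = psi z -> y = z.
Proof.
move=> y0 z0 /eqP; rewrite -subr_eq0 /psi !div1r => /eqP E.
have : (y - z) * (1 + (y * z)^-1) = 0.
  by rewrite -[RHS]E; field; rewrite !gt_eqF.
move=> /eqP; rewrite mulf_eq0 subr_eq0 => /orP[/eqP//|].
by rewrite gt_eqF// addr_gt0 ?invr_gt0 ?mulr_gt0.
Qed.

(** * Orbits of [psi] and the limit formula *)

Section orbit.
Context (R : realType) (x : nat -> R).
Hypotheses (x_0 : x 0%N = 1) (x_gt0 : forall n, 0 < x n)
  (x_rec : forall n, x n = psi (x n.+1)).

Lemma orbit_recE n : x n.+1 ^+ 2 = 1 + x n * x n.+1.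
Proof.
by rewrite [x n]x_rec /psi; field; rewrite gt_eqF.
Qed.

Lemma orbit_le n : x n <= x n.+1.
Proof. by rewrite {1}x_rec /psi div1r gerBl invr_ge0 ltW. Qed.

Lemma orbit_ge1 n : 1 <= x n.
Proof. by elim: n => [|n IH]; [rewrite x_0|exact: le_trans IH (orbit_le n)]. Qed.

(** Each step adds at least 1 to the square, as x_(n+1)^2 = 1 + x_n x_(n+1) >= 1 + x_n^2. *)
Lemma orbit_sqr_ge n : n.+1%:R <= x n ^+ 2.
Proof.
elim: n => [|n IH]; first by rewrite x_0 expr1n.
rewrite orbit_recE -natr1 addrC lerD2l; apply: le_trans IH _.
by rewrite expr2 ler_wpM2l ?orbit_le// ltW.
Qed.

Lemma orbit_inv_cvg0 : (fun n => (x n)^-1) @ \oo --> (0 : R).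
Proof.
apply/cvgrPdist_le => e e0; near=> n.
rewrite sub0r normrN ger0_norm ?invr_ge0 ?(ltW (x_gt0 n))//.
rewrite -[leRHS]invrK lef_pV2 ?posrE ?invr_gt0//.
rewrite -(@ler_pXn2r R 2 isT) ?nnegrE ?invr_ge0 ?(ltW e0) ?(ltW (x_gt0 _))//.
apply: le_trans (orbit_sqr_ge n); apply: (@le_trans _ _ n%:R); last by rewrite ler_nat.
by near: n; exact: nbhs_infty_ger.
Unshelve. all: by end_near.
Qed.

(* [psi] stretches [[z, w]] by [1 + 1 / (z w)], and
   [1 + 1 / x_(j+1)^2 <= 1 / (1 - 1 / x_(j+1)^2) = x_(j+1) / x_j] telescopes. *)
Lemma iter_psi_dist j z w : x j <= z -> z <= w ->
  0 <= iter j.+1 (@psi R) w - iter j.+1 (@psi R) z <= 2 * x j * (w - z).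
Proof.
have psiB (a b c : R) : 0 < c -> c <= a -> a <= b ->
    0 <= psi b - psi a <= (1 + (c ^+ 2)^-1) * (b - a).
  move=> c0 ca ab; have a0 := lt_le_trans c0 ca; have b0 := lt_le_trans a0 ab.
  have -> : psi b - psi a = (1 + (b * a)^-1) * (b - a).
    by rewrite /psi !div1r; field; rewrite !gt_eqF.
  have ab0 : 0 <= b - a by rewrite subr_ge0.
  apply/andP; split.
    by rewrite mulr_ge0// addr_ge0// invr_ge0 mulr_ge0// ltW.
  rewrite ler_wpM2r// lerD2l lef_pV2 ?posrE ?mulr_gt0 ?exprn_gt0//.
  by rewrite expr2 ler_pM ?(ltW c0)// (le_trans ca).
elim: j z w => [|j IH] z w xz zw.
  (* A single iteration stretches by at most 1 + 1 / x_0^2 = 2, whence the constant 2. *)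
  have := psiB z w 1 ltr01 _ zw; rewrite -x_0 => /(_ xz).
  by rewrite /= x_0 expr1n invr1 mulr1 -[1 + 1]/2%:R.
have /andP[h0 h1] := psiB z w _ (x_gt0 _) xz zw.
(* [psi] is increasing and sends x_(j+1) to x_j, so the lower bound survives each iteration. *)
have xz' : x j <= psi z.
  rewrite x_rec; have /andP[+ _] := psiB (x j.+1) z _ (x_gt0 _) (lexx _) xz.
  by rewrite subr_ge0.
have zw' : psi z <= psi w by rewrite -subr_ge0.
have /andP[h2 h3] := IH _ _ xz' zw'.
rewrite !(iterSr j.+1) h2/=; apply: (le_trans h3).
apply: (le_trans (ler_wpM2l _ h1)); first by rewrite mulr_ge0// ltW.
rewrite mulrA ler_wpM2r ?subr_ge0// -mulrA ler_wpM2l//.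
set y := x j.+1; have y0 : 0 < y := x_gt0 _.
have -> : x j * (1 + (y ^+ 2)^-1) = y - (y ^+ 3)^-1.
  by rewrite x_rec -/y /psi; field; rewrite gt_eqF.
by rewrite gerBl invr_ge0 exprn_ge0// ltW.
Qed.

Variable g : R -> R.
Hypotheses (g_gt0 : forall s, 0 < s -> 0 < g s) (g_1 : g 1 = 1)
  (g_conc : forall l a b, 0 <= l <= 1 -> 0 < a -> 0 < b ->
    l * ln (g a) + (1 - l) * ln (g b) <= ln (g (l * a + (1 - l) * b)))
  (g_rec : forall s, 0 < s -> g s = psi (g (s + 1))).

Lemma g_natE n : g n.+1%:R = x n.
Proof.
elim: n => [|n IH]; first by rewrite g_1 x_0.
apply: psi_inj; rewrite ?g_gt0 ?ltr0n//.
by rewrite -x_rec -IH [RHS]g_rec ?ltr0n// natr1.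
Qed.

Lemma iter_psi_g n s : 0 < s -> iter n (@psi R) (g (s + n%:R)) = g s.
Proof.
move=> s0; elim: n => [|n IH]; first by rewrite addr0.
by rewrite iterSr -natr1 addrA -g_rec ?IH// ltr_wpDr.
Qed.

(* Concavity of [ln g] on the points [n], [n + s], [n + 1]. *)
Lemma g_ge n s : 0 < s <= 1 -> x n * (x n.+1 / x n) `^ s <= g (s + n.+1%:R).
Proof.
move=> /andP[s0 s1].
have gs : 0 < g (s + n.+1%:R) by rewrite g_gt0// ltr_wpDr.
have xx : 0 < x n.+1 / x n by rewrite divr_gt0.
rewrite -ler_ln ?posrE ?mulr_gt0 ?powR_gt0//.
rewrite lnM ?posrE ?powR_gt0// ln_powR ln_div ?posrE//.
have := @g_conc s n.+2%:R n.+1%:R; rewrite (ltW s0) s1 !ltr0n !g_natE.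
move=> /(_ isT isT isT).
have -> : s * n.+2%:R + (1 - s) * n.+1%:R = s + n.+1%:R.
  by rewrite -(natr1 n.+1); ring.
by lra.
Qed.

(* Concavity of [ln g] on the points [n - 1], [n], [n + s]. *)
Lemma g_le n s : 0 < s -> g (s + n.+2%:R) <= x n.+1 * (x n.+1 / x n) `^ s.
Proof.
move=> s0.
have gs : 0 < g (s + n.+2%:R) by rewrite g_gt0// ltr_wpDr.
have xx : 0 < x n.+1 / x n by rewrite divr_gt0.
rewrite -ler_ln ?posrE ?mulr_gt0 ?powR_gt0//.
rewrite lnM ?posrE ?powR_gt0// ln_powR ln_div ?posrE//.
have s1 : 0 < 1 + s by rewrite addr_gt0.
have := @g_conc (1 + s)^-1 (s + n.+2%:R) n.+1%:R.
rewrite invr_ge0 (ltW s1) invf_le1// lerDl (ltW s0) ltr0n ltr_wpDr// g_natE.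
move=> /(_ isT isT isT).
have -> : (1 + s)^-1 * (s + n.+2%:R) + (1 - (1 + s)^-1) * n.+1%:R = n.+2%:R.
  by rewrite -(natr1 n.+1); field; rewrite gt_eqF.
rewrite g_natE -(ler_pM2l s1).
have -> : (1 + s) * ((1 + s)^-1 * ln (g (s + n.+2%:R)) + (1 - (1 + s)^-1) * ln (x n)) =
   ln (g (s + n.+2%:R)) + s * ln (x n) by field; rewrite gt_eqF.
by lra.
Qed.

(** The iterated point is the lower bound of [g_ge]. Its gap to the upper bound of [g_le] is at most
    2 / x_(n+1)^2, and the iterations stretch this by at most 2 x_(n+1). *)
Lemma iter_psi_dist_g n s : 0 < s <= 1 ->
  0 <= g s - iter n.+2 (@psi R) (x n.+1 * (x n.+2 / x n.+1) `^ s) <= 4 * (x n.+1)^-1.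
Proof.
move=> /[dup] /g_ge ge /andP[s0 s1].
set a := _ * _ `^ _.
have X0 := x_gt0 n; have X1 := x_gt0 n.+1; have X2 := x_gt0 n.+2.
set q := x n.+2 / x n.+1 in a *.
have q1 : 1 <= q by rewrite ler_pdivlMr// mul1r orbit_le.
have q0 : 0 < q := lt_le_trans ltr01 q1.
have xa : x n.+1 <= a.
  by rewrite ler_peMr ?(ltW X1)// -(powRr0 q) ler_powR// ltW.
have /andP[h0 h1] := iter_psi_dist xa (ge _).
rewrite iter_psi_g// in h0 h1; rewrite h0/=; apply: (le_trans h1).
have x12 : x n.+1 <= x n.+2 := orbit_le _.
(* Both terms come from x_(n+2) - x_(n+1) = 1 / x_(n+2), and each is at most 1 / x_(n+1)^2. *)
have defectE : x n.+1 ^+ 2 - x n * x n.+2 = (x n.+2 ^+ 2)^-1 + (x n.+1 * x n.+2)^-1.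
  have Y : (x n.+2)^-1 = x n.+2 - x n.+1 by rewrite [x n.+1]x_rec /psi div1r; ring.
  rewrite [x n]x_rec /psi -exprVn invfM Y.
  suff : x n.+2 ^+ 2 - (1 + x n.+1 * x n.+2) = 0.
    by move=> E; apply/eqP; rewrite -subr_eq0 -oppr_eq0 -E; apply/eqP; field; rewrite gt_eqF.
  by rewrite -orbit_recE subrr.
have defect : x n.+1 ^+ 2 - x n * x n.+2 <= 2 / x n.+1 ^+ 2.
  rewrite defectE mulr_natl mulr2n.
  by rewrite lerD// lef_pV2 ?posrE ?mulr_gt0 ?exprn_gt0// expr2 ler_pM// ltW.
have defect0 : x n * x n.+2 <= x n.+1 ^+ 2.
  by rewrite -subr_ge0 defectE addr_ge0// invr_ge0 ?sqr_ge0// mulr_ge0// ltW.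
(* The bound of [g_le] is x_(n+1) (q r)^s, which is at most [a * r] because r >= 1 and s <= 1. *)
set r := (x n.+1 / x n) / q.
have r1 : 1 <= r.
  rewrite ler_pdivlMr// mul1r ler_pdivrMr// mulrAC ler_pdivlMr// -expr2.
  by rewrite mulrC.
have gE : g (s + n.+2%:R) <= a * r.
  apply: (le_trans (g_le _ s0)).
  rewrite /a -mulrA ler_wpM2l ?(ltW X1)//.
  have -> : x n.+1 / x n = q * r by rewrite /r mulrCA divff ?gt_eqF// mulr1.
  rewrite powRM ?(ltW q0)// ?(le_trans _ r1)// ler_wpM2l ?powR_ge0//.
  exact: ler1_powR.
have aY : a <= x n.+2.
  rewrite /a mulrC -ler_pdivlMr//; exact: ler1_powR.
have ga : g (s + n.+2%:R) - a <= x n.+2 * (r - 1).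
  apply: (@le_trans _ _ (a * (r - 1))).
    by rewrite mulrBr mulr1 lerB.
  by rewrite ler_wpM2r// subr_ge0.
have XY : 0 <= 2 * x n.+1 by rewrite mulr_ge0// ltW.
apply: (le_trans (ler_wpM2l XY ga)).
have -> : x n.+2 * (r - 1) = (x n.+1 ^+ 2 - x n * x n.+2) / x n.
  by rewrite /r /q; field; rewrite !gt_eqF.
apply: (@le_trans _ _ (2 * x n.+1 * (2 / x n.+1 ^+ 2))).
  rewrite ler_wpM2l//; apply: le_trans defect.
  by rewrite ler_piMr ?subr_ge0// invf_le1// orbit_ge1.
by rewrite le_eqVlt; apply/predU1P; left; field; rewrite gt_eqF.
Qed.

Lemma iter_psi_cvg s : 0 < s <= 1 ->
  (fun n => iter n (@psi R) (x n.-1 * (x n / x n.-1) `^ s)) @ \oo --> g s.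
Proof.
(* The shift drops the ranks 0 and 1, for which [iter_psi_dist_g] gives no estimate. *)
move=> s01; rewrite -(cvg_shiftn 2)/=; apply/cvgrPdist_le => e e0.
have e40 : 0 < e / 4 by rewrite divr_gt0.
have := orbit_inv_cvg0; rewrite -cvg_shiftS => /cvgrPdist_le/(_ _ e40) H.
near=> n.
rewrite addn2 /=.
have /andP[h0 h1] := iter_psi_dist_g n s01.
rewrite ger0_norm//; apply: (le_trans h1); rewrite mulrC -ler_pdivlMr//.
suff : `|0 - (x n.+1)^-1| <= e / 4.
  by rewrite sub0r normrN ger0_norm// invr_ge0 ltW.
by near: n.
Unshelve. all: by end_near.
Qed.
End orbit.

(** * Bounds, concavity and measurability of the kernel *)

Lemma convex_powR_exponent (R : realType) (t l a b : R) :
  0 <= t -> 0 <= l <= 1 -> 0 < a -> 0 < b ->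
  t `^ (l * a + (1 - l) * b) <= l * t `^ a + (1 - l) * t `^ b.
Proof.
move=> t0 l01 a0 b0; have /andP[l0 l1] := l01.
have ab0 := i01_comb_gt0 l01 a0 b0.
have [->|tN0] := eqVneq t 0; first by rewrite !powR0 ?gt_eqF// !mulr0 addr0.
have [i <-] := i01_exists l01.
have := convex_expR i (a * ln t) (b * ln t).
by rewrite !convRE /unstable.onem /powR (negbTE tN0) (mulrDl (i%:num * a)) -!mulrA.
Qed.

Lemma kernel_f0 (R : realType) (t : R) : kernel_f 0 t = 0.
Proof. by rewrite /kernel_f powRr0 subrr mul0r; case: ifP. Qed.

(** For s > 0 the upper bound combines t^n <= t^s with 1 - t^n <= n (1 - t). This boundedness makes
    the kernel integrable. *)
Lemma kernel_f_le (R : realType) (s t : R) (n : nat) : 0 <= s <= n%:R -> 0 <= t <= 1 ->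
  0 <= kernel_f s t <= n%:R.
Proof.
move=> /andP[]; rewrite le_eqVlt => /predU1P[<- n0 _|sp sn /andP[t0 t1]].
  by rewrite kernel_f0 lexx.
have s0 := ltW sp; rewrite /kernel_f.
have [_|tN1] := eqVneq t 1; first by rewrite s0.
have t1' : 0 < 1 - t by rewrite subr_gt0 lt_neqAle tN1.
rewrite divr_ge0 ?(ltW t1') ?subr_ge0 ?powR_le1 ?t0//= ler_pdivrMr//.
apply: le_trans (_ : 1 - t ^+ n <= _); last first.
  by have := subrX_le n t0 t1 (lexx _); rewrite expr1n.
rewrite lerB// -powR_mulrn//.
have [->|tN0] := eqVneq t 0; last by rewrite ger_powR// t1 lt_neqAle eq_sym tN0 t0.
by rewrite (@powR0 _ n%:R) ?powR_ge0// gt_eqF// (lt_le_trans sp).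
Qed.

(** With u = t^s, n (1 - u) >= 1 - u^n >= 1 - t, as s n >= 1. The kernel is thus bounded below
    uniformly in [t], which makes [f] positive. *)
Lemma kernel_f_ge (R : realType) (s t : R) (n : nat) : 1 <= s * n%:R -> 0 <= s -> 0 <= t <= 1 ->
  1 <= n%:R * kernel_f s t.
Proof.
move=> sn s0 /andP[t0 t1]; rewrite /kernel_f mulrC.
have [_//|tN1] := eqVneq t 1.
have t1' : 0 < 1 - t by rewrite subr_gt0 lt_neqAle tN1.
rewrite mulrAC ler_pdivlMr// mul1r mulrC.
have ts1 : t `^ s <= 1 by rewrite powR_le1// t0.
apply: le_trans (subrX_le n (powR_ge0 t s) ts1 (lexx _)).
rewrite expr1n -powR_mulrn ?powR_ge0// -powRrM lerB//.
have [->|tN0] := eqVneq t 0; first by rewrite powR0// gt_eqF// (lt_le_trans ltr01).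
by rewrite ge1r_powR// t1 lt_neqAle eq_sym tN0 t0.
Qed.

Lemma kernel_f_concave (R : realType) (t l a b : R) :
  0 <= t <= 1 -> 0 <= l <= 1 -> 0 < a -> 0 < b ->
  l * kernel_f a t + (1 - l) * kernel_f b t <= kernel_f (l * a + (1 - l) * b) t.
Proof.
move=> /andP[t0 t1] l01 a0 b0; rewrite /kernel_f; have [//|tN1] := eqVneq t 1.
have t1' : 0 < 1 - t by rewrite subr_gt0 lt_neqAle tN1.
rewrite !mulrA -mulrDl ler_wpM2r ?invr_ge0 ?(ltW t1')//.
have := convex_powR_exponent t0 l01 a0 b0.
by lra.
Qed.

Lemma kernel_fS (R : realType) (s t : R) : 0 <= s -> 0 <= t ->
  kernel_f (s + 1) t = kernel_f s t + t `^ s.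
Proof.
move=> s0 t0; rewrite /kernel_f; have [->|tN1] := eqVneq t 1; first by rewrite powR1.
have t1' : 1 - t != 0 by rewrite subr_eq0 eq_sym.
rewrite powRD ?powRr1//; last first.
  by rewrite gt_eqF// ltr_pwDr.
by field.
Qed.

Lemma measurable_kernel_f (R : realType) (s : R) :
  @measurable_fun _ _ R R `[0, 1]%classic (kernel_f s).
Proof.
(* The inverse is written as the power -1, legitimate since 1 - t >= 0, so that measurability of
   [powR] applies. *)
apply: (@eq_measurable_fun _ _ _ _ _
    (fun t : R => if t == 1 then s else (1 - t `^ s) * (1 - t) `^ (-1))).
  move=> t; rewrite inE/= in_itv/= => /andP[t0 t1]; rewrite /kernel_f.
  by case: ifP => // _; rewrite powR_inv1// subr_ge0.
apply: measurable_funTS; apply: measurable_fun_ifT => //=.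
  by apply: measurable_fun_eqr.
apply: measurable_funM.
  by apply: measurable_funB => //; exact: measurable_powR.
have mp : @measurable_fun _ _ R R [set: R] (fun x => x `^ (-1)) by exact: measurable_powR.
apply: (measurableT_comp mp).
exact: measurable_funB.
Qed.

(** * Integrals against a probability carried by [0, 1] *)

Section unit_interval_integral.
Context (R : realType) (mu : probability R R).
Hypothesis mu01 : mu `[0, 1]%classic = 1%E.

Lemma bounded_integrable01 (F : R -> R) (M : R) : @measurable_fun _ _ R R `[0, 1]%classic F ->
  (forall t, 0 <= t <= 1 -> `|F t| <= M) -> mu.-integrable `[0, 1]%classic (EFin \o F).
Proof.
move=> mF FM; apply: measurable_bounded_integrable => //.
  by rewrite [ltLHS]mu01 ltry.
exists M; split; first exact: num_real.
move=> N MN t; rewrite /= in_itv/= => t01.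
by rewrite (le_trans (FM _ t01))// ltW.
Qed.

Lemma integrable_powR01 (s : R) : 0 <= s ->
  mu.-integrable `[0, 1]%classic (EFin \o (fun t : R => t `^ s)).
Proof.
move=> s0; apply: (@bounded_integrable01 _ 1).
  by apply: measurable_funTS; exact: measurable_powR.
by move=> t t01; rewrite ger0_norm ?powR_ge0// powR_le1.
Qed.

Lemma integrable_kernel_f (s : R) : 0 <= s ->
  mu.-integrable `[0, 1]%classic (EFin \o kernel_f s).
Proof.
move=> s0; apply: (@bounded_integrable01 _ (Num.Def.trunc s).+1%:R).
  exact: measurable_kernel_f.
move=> t /(@kernel_f_le _ s _ (Num.Def.trunc s).+1).
rewrite s0 ltW ?truncnS_gt// => /(_ isT)/andP[k0 k1].
by rewrite ger0_norm.
Qed.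

Lemma Rintegral01_cst (c : R) : \int[mu]_(t in `[0, 1]%classic) c = c.
Proof. by rewrite Rintegral_cst// [X in fine X]mu01 mulr1. Qed.

Lemma Rintegral_sum01 (n : nat) (c : nat -> R) (F : nat -> R -> R) :
  (forall i, mu.-integrable `[0, 1]%classic (EFin \o F i)) ->
  mu.-integrable `[0, 1]%classic (EFin \o (fun t => \sum_(i < n) c i * F i t)) /\
  \int[mu]_(t in `[0, 1]%classic) (\sum_(i < n) c i * F i t) =
  \sum_(i < n) c i * \int[mu]_(t in `[0, 1]%classic) F i t.
Proof.
move=> iF; elim: n => [|n [IH1 IH2]].
  have -> : (fun t => \sum_(i < 0) c i * F i t) = cst 0.
    by apply/funext => t; rewrite big_ord0.
  rewrite Rintegral01_cst big_ord0; split=> //.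
  by apply: (@bounded_integrable01 _ 0) => // t _; rewrite normr0.
have icF : mu.-integrable `[0, 1]%classic (EFin \o (fun t => c n * F n t)).
  by have := integrableZl (measurable_itv _) (c n) (iF n).
have -> : (fun t => \sum_(i < n.+1) c i * F i t) =
    (fun t => \sum_(i < n) c i * F i t + c n * F n t).
  by apply/funext => t; rewrite big_ord_recr.
split; first by have := integrableD _ IH1 icF; apply.
by rewrite RintegralD// IH2 RintegralZl// big_ord_recr.
Qed.

End unit_interval_integral.

(** * Positivity, concavity and functional equation of [f] *)

Section fixed_point.
Context (R : realType) (m : nat -> R) (mu : probability R R).
Hypotheses (m_0 : m 0%N = 1) (m_gt0 : forall n, 0 < m n)
  (m_rec : forall n, (0 < n)%N -> (1 + \sum_(1 <= k < n.+1) m k) * m n = 1)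
  (mu01 : mu `[0, 1]%classic = 1%E)
  (mu_moment : forall n,
    (\int[mu]_(t in `[0%R, 1%R]%classic) ((t : R) ^+ n)%:E = (m n)%:E)%E).

Local Notation f := (f_mu mu).
Local Notation "'\E' F" := (\int[mu]_(t in `[0, 1]%classic) F t)
  (at level 10, F at level 8).

Lemma m_inv_rec n : (m n)^-1 = psi ((m n.+1)^-1).
Proof.
(* The case k = 0 also holds, with m_0 = 1 and an empty sum. Consecutive inverses then differ by one
   term of the sequence. *)
have mE k : (m k)^-1 = 1 + \sum_(1 <= i < k.+1) m i.
  case: k => [|k]; first by rewrite m_0 invr1 big_geq// addr0.
  by rewrite -[LHS]mul1r -[X in X / _](m_rec (ltn0Sn k)) mulfK// gt_eqF.
by rewrite /psi div1r invrK !mE [in RHS]big_nat_recr//= addrA addrK.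
Qed.

Let m_inv_0 : (m 0%N)^-1 = 1. Proof. by rewrite m_0 invr1. Qed.

Let m_inv_gt0 n : 0 < (m n)^-1. Proof. by rewrite invr_gt0. Qed.

Lemma integrable_X n : mu.-integrable `[0, 1]%classic (EFin \o (fun t : R => t ^+ n)).
Proof.
apply: (bounded_integrable01 mu01 (M := 1)).
  by apply: measurable_funTS; exact: exprn_measurable.
move=> t /andP[t0 t1]; rewrite ger0_norm ?exprn_ge0// exprn_ile1//.
Qed.

Lemma Rintegral_X n : \E (fun t : R => t ^+ n) = m n.
Proof. by rewrite /Rintegral mu_moment. Qed.

Lemma Rintegral_powR_nat n : \E (fun t : R => t `^ n%:R) = m n.
Proof.
rewrite -Rintegral_X; apply: eq_Rintegral => t.
by rewrite inE/= in_itv/= => /andP[t0 _]; rewrite powR_mulrn.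
Qed.

(** The mass at 1 is below every moment m_n, and m_n tends to 0. *)
Lemma mu_set1 : mu [set 1] = 0%E.
Proof.
have mu1_le n : fine (mu [set 1]) <= m n.
  rewrite -Rintegral_X.
  have -> : fine (mu [set 1]) = \E (\1_[set 1]).
    rewrite /Rintegral integral_indic//; congr (fine (mu _)).
    apply/seteqP; split=> [t ->|t []//]; split=> //=.
    by rewrite in_itv/= ler01 lexx.
  apply: le_Rintegral => //.
  - apply: (bounded_integrable01 mu01 (M := 1)); first exact: measurable_indic.
    by move=> t _; rewrite ger0_norm// indicE; case: (_ \in _).
  - exact: integrable_X.
  - move=> t; rewrite /= in_itv/= => /andP[t0 t1]; rewrite indicE.
    have [->|tN1] := eqVneq t 1; first by rewrite mem_set// expr1n.
    by rewrite memNset ?exprn_ge0//; apply/eqP.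
have : fine (mu [set 1]) <= 0.
  apply: (cvgr_to_ge (orbit_inv_cvg0 m_inv_0 m_inv_gt0 m_inv_rec)).
  by apply: nearW => n; rewrite invrK.
have mu1fin : mu [set 1] \is a fin_num by exact: fin_num_measure.
rewrite -[mu _]fineK// => mu1; congr (_%:E); apply/eqP.
by rewrite eq_le mu1 fine_ge0.
Qed.

(** As the point 1 is negligible, integrands are compared only where 1 - t > 0, so quotients by 1 -
    t need no separate case. *)
Lemma le_Rintegral01 (F G : R -> R) :
  mu.-integrable `[0, 1]%classic (EFin \o F) -> mu.-integrable `[0, 1]%classic (EFin \o G) ->
  (forall t, 0 <= t < 1 -> F t <= G t) -> \E F <= \E G.
Proof.
move=> iF iG FG.
have E (H : R -> R) : mu.-integrable `[0, 1]%classic (EFin \o H) ->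
    \E H = \int[mu]_(t in `[0, 1] `\` [set 1]) H t.
  move=> iH; rewrite /Rintegral.
  by rewrite (@negligible_integral _ _ R mu _ ([set 1] : set R))//; exact: mu_set1.
have mD : measurable (`[0, 1] `\` [set 1] : set R) by exact: measurableD.
rewrite !E//; apply: le_Rintegral => //.
- exact: integrableS iF.
- exact: integrableS iG.
- move=> t [] /=; rewrite in_itv/= => /andP[t0 t1] /eqP tN1.
  by apply: FG; rewrite t0 lt_neqAle tN1.
Qed.

Lemma f_muD1 s : 0 <= s -> f (s + 1) = f s + \E (fun t : R => t `^ s).
Proof.
move=> s0; rewrite /f_mu -RintegralD//.
- apply: eq_Rintegral => t; rewrite inE/= in_itv/= => /andP[t0 _].
  exact: kernel_fS.
- exact: integrable_kernel_f.
- exact: integrable_powR01.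
Qed.

Lemma f_mu_nat n : f n.+1%:R = (m n)^-1.
Proof.
elim: n => [|n IH]; rewrite -natr1 f_muD1// Rintegral_powR_nat.
  (* The base case rests on f 0 = 0. *)
  rewrite m_inv_0 m_0 mulr0n /f_mu.
  have -> : kernel_f 0 = cst (0 : R).
    by apply/funext => t; rewrite kernel_f0.
  by rewrite Rintegral01_cst// add0r.
by rewrite IH m_inv_rec /psi div1r invrK subrK.
Qed.

Lemma f_mu_gt0 s : 0 < s -> 0 < f s.
Proof.
move=> s0; set n := (Num.Def.trunc s^-1).+1.
have n0 : 0 < n%:R :> R by rewrite ltr0n.
have sn : 1 <= s * n%:R.
  by rewrite mulrC -ler_pdivrMr// div1r ltW// truncnS_gt.
rewrite -(pmulr_rgt0 _ n0) (lt_le_trans ltr01)//.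
rewrite -[leLHS](Rintegral01_cst mu01) /f_mu -RintegralZl//; last first.
  by apply: integrable_kernel_f => //; exact: ltW.
apply: le_Rintegral01.
- by apply: (bounded_integrable01 mu01 (M := 1)) => // t _; rewrite normr1.
- by have := integrableZl (measurable_itv _) n%:R (integrable_kernel_f mu01 (ltW s0)).
- move=> t /andP[t0 /ltW t1].
  by apply: kernel_f_ge => //; rewrite ?t0// ltW.
Qed.

Lemma f_mu_concave l a b : 0 <= l <= 1 -> 0 < a -> 0 < b ->
  l * f a + (1 - l) * f b <= f (l * a + (1 - l) * b).
Proof.
move=> l01 a0 b0.
have ia := integrable_kernel_f mu01 (ltW a0).
have ib := integrable_kernel_f mu01 (ltW b0).
have iab := integrable_kernel_f mu01 (ltW (i01_comb_gt0 l01 a0 b0)).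
have ila := integrableZl (measurable_itv _) l ia.
have ilb := integrableZl (measurable_itv _) (1 - l) ib.
rewrite /f_mu -RintegralZl// -RintegralZl// -RintegralD//.
apply: le_Rintegral01 => //.
  by have := integrableD (measurable_itv _) ila ilb.
by move=> t /andP[t0 t1]; apply: kernel_f_concave => //; rewrite t0 ltW.
Qed.

(* The operator [A v x = \int (v x - t v (t x)) / (1 - t) dmu t] is diagonal on powers,
   [A (t ^ s) = f (s + 1) t ^ s], and at a minimum point [x] of [v] the integrand is at
   most [v x], so that [A v x <= v x]. *)
Lemma powR_comb_ge0 (n : nat) (c e : nat -> R) : (forall i, 0 <= e i) ->
  (forall x, 0 <= x <= 1 -> 0 <= \sum_(i < n) c i * f (e i + 1) * x `^ e i) ->
  forall x, 0 <= x <= 1 -> 0 <= \sum_(i < n) c i * x `^ e i.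
Proof.
move=> e0 H; pose v x := \sum_(i < n) c i * x `^ e i.
have cv : {within `[0, 1], continuous v}.
  rewrite /v; elim: n {H v} => [|n IH].
    have -> : (fun x => \sum_(i < 0) c i * x `^ e i) = cst 0.
      by apply/funext => x; rewrite big_ord0.
    by apply: continuous_subspaceT => x; exact: cst_continuous.
  have -> : (fun x => \sum_(i < n.+1) c i * x `^ e i) =
      (fun x => \sum_(i < n) c i * x `^ e i) + (fun x => c n * x `^ e n).
    by apply/funext => x; rewrite big_ord_recr.
  apply: within_continuousD => // x.
  by apply: cvgMr; exact: within_continuous_powR.
have [y] := EVT_min ler01 cv; rewrite in_itv/= => y01 ymin.
suff vy : 0 <= v y.
  by move=> x x01; apply: le_trans vy _; apply: ymin; rewrite in_itv.
apply: le_trans (H _ y01) _; have /andP[y0 y1] := y01.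
have ik i := integrable_kernel_f mu01 (addr_ge0 (e0 i) ler01).
have [iS ES] := Rintegral_sum01 mu01 n (fun i => c i * y `^ e i) ik.
have -> : \sum_(i < n) c i * f (e i + 1) * y `^ e i =
    \E (fun t => \sum_(i < n) c i * y `^ e i * kernel_f (e i + 1) t).
  by rewrite ES; apply: eq_bigr => i _; rewrite mulrAC.
rewrite -[leRHS](Rintegral01_cst mu01); apply: le_Rintegral01 => //.
  apply: (bounded_integrable01 mu01 (M := `|v y|)) => //.
move=> t /andP[t0 t1].
have t1' : 0 < 1 - t by rewrite subr_gt0.
have -> : \sum_(i < n) c i * y `^ e i * kernel_f (e i + 1) t = (v y - t * v (y * t)) / (1 - t).
  rewrite /v mulr_sumr -sumrB mulr_suml; apply: eq_bigr => i _.
  rewrite /kernel_f lt_eqF// powRM// powRD ?powRr1//; last first.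
    by rewrite gt_eqF// ltr_pwDr.
  by field; rewrite gt_eqF.
(* Minimality of [v y] enters through v y <= v (y t). *)
rewrite ler_pdivrMr// mulrBr mulr1 lerB// mulrC ler_wpM2l//.
apply: ymin; rewrite in_itv/= mulr_ge0//=.
by rewrite mulr_ile1// ltW.
Qed.

Lemma Rintegral_horner (q : {poly R}) :
  mu.-integrable `[0, 1]%classic (EFin \o (fun t => q.[t])) /\
  \E (fun t => q.[t]) = \sum_(i < size q) q`_i * m i.
Proof.
have [iS ES] := Rintegral_sum01 mu01 (size q) (fun i => q`_i) integrable_X.
have -> : (fun t => q.[t]) = (fun t => \sum_(i < size q) q`_i * t ^+ i).
  by apply/funext => t; rewrite horner_coef.
by split=> //; rewrite ES; under eq_bigr do rewrite Rintegral_X.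
Qed.

(** [powR_comb_ge0] is applied to the coefficients q_i m_i and c / f (s + 1). The factors f (e_i +
    1) turn them back into q_i, as f (i + 1) = 1 / m_i, and into c. The conclusion is read at x =
    1. *)
Lemma poly_powR_ge0 (q : {poly R}) (c s : R) : 0 <= s ->
  (forall t, 0 <= t <= 1 -> 0 <= q.[t] + c * t `^ s) ->
  0 <= \E (fun t => q.[t]) + c / f (s + 1).
Proof.
move=> s0 H; have fs0 : 0 < f (s + 1) by rewrite f_mu_gt0// ltr_pwDr.
(* Indices below [size q] carry the monomials of [q]; the index [size q] carries t^s. *)
pose a i := if (i < size q)%N then q`_i * m i else c / f (s + 1).
pose e i := if (i < size q)%N then i%:R else s.
have e0 i : 0 <= e i by rewrite /e; case: ifP.
have aE : a (size q) = c / f (s + 1) by rewrite /a ltnn.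
have eE : e (size q) = s by rewrite /e ltnn.
have := @powR_comb_ge0 (size q).+1 a e e0 _ 1.
rewrite big_ord_recr/=  aE eE powR1 mulr1 (Rintegral_horner q).2.
have -> : \sum_(i < size q) a i * 1 = \sum_(i < size q) q`_i * m i.
  by apply: eq_bigr => i _; rewrite mulr1 /a ltn_ord.
apply; rewrite ?ler01 ?lexx// => x x01; have /andP[x0 _] := x01.
rewrite big_ord_recr/= aE eE divfK ?gt_eqF//.
have -> : \sum_(i < size q) a i * f (e i + 1) * x `^ e i = q.[x].
  rewrite horner_coef; apply: eq_bigr => i _; rewrite /a /e ltn_ord.
  by rewrite natr1 f_mu_nat powR_mulrn// mulfK ?gt_eqF.
exact: H.
Qed.

(** Let t^s <= p <= t^s + e. Positivity for p - t^s gives 1 / f (s + 1) <= \int p <= \int t^s + e,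
    and positivity for e - p + t^s gives \int t^s <= \int p <= 1 / f (s + 1) + e. *)
Lemma Rintegral_powR s : 0 <= s -> \E (fun t : R => t `^ s) = (f (s + 1))^-1.
Proof.
move=> s0.
have approx e : 0 < e -> exists p : {poly R}, forall t, 0 <= t <= 1 ->
    0 <= p.[t] - t `^ s <= e.
  move=> e0; have [p Hp] := powR_poly_approx s0 (divr_gt0 e0 (ltr0n R 2)).
  (* A two-sided error e / 2, shifted up by e / 2, becomes one-sided. *)
  exists (p + (e / 2)%:P) => t /Hp; rewrite ler_norml hornerD hornerC.
  by lra.
have ip := integrable_powR01 mu01 s0.
apply/eqP; rewrite eq_le; apply/andP; split; apply/ler_addgt0Pr => e e0.
- have [p Hp] := approx e e0; have [iq _] := Rintegral_horner p.
  have := @poly_powR_ge0 (e%:P - p) 1 s s0.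
  have -> : \E (fun t => (e%:P - p).[t]) = e - \E (fun t => p.[t]).
    rewrite -[X in _ = X - _](Rintegral01_cst mu01) -RintegralB//.
      by apply: eq_Rintegral => t _; rewrite hornerD hornerN hornerC.
    by apply: (bounded_integrable01 mu01 (M := `|e|)).
  rewrite div1r => h; apply: (@le_trans _ _ (\E (fun t => p.[t]))).
    apply: le_Rintegral01 => // t /andP[t0 /ltW t1].
    by have := Hp t; rewrite t0 t1 subr_ge0 => /(_ isT)/andP[].
  rewrite -subr_ge0 [X in X - _]addrC -addrA [X in _ + X]addrC addrA; apply: h => t /Hp.
  by rewrite hornerD hornerN hornerC mul1r; lra.
- have [p Hp] := approx e e0; have [iq _] := Rintegral_horner p.
  have := @poly_powR_ge0 p (-1) s s0.
  rewrite mulN1r subr_ge0 => /(_ _)/le_trans; apply.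
    by move=> t /Hp; rewrite mulN1r => /andP[].
  have ie : mu.-integrable `[0, 1]%classic (EFin \o cst e).
    by apply: (bounded_integrable01 mu01 (M := `|e|)).
  rewrite -[X in _ + X](Rintegral01_cst mu01) -RintegralD//.
  apply: le_Rintegral01 => //.
    by have := integrableD (measurable_itv _) ip ie.
  move=> t /andP[t0 /ltW t1].
  by have := Hp t; rewrite t0 t1 => /(_ isT)/=; lra.
Qed.

Lemma f_mu_psi s : 0 < s -> f s = psi (f (s + 1)).
Proof.
by move=> /ltW s0; rewrite /psi div1r -Rintegral_powR// [f (s + 1)]f_muD1// addrK.
Qed.

End fixed_point.

(** * Characterization of [f] by (i)-(iii) *)

Theorem theorem1p2 (R : realType) (m : nat -> R) (mu : probability R R)
  (hm0 : m 0%N = 1)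
  (hmpos : forall n, 0 < m n)
  (hmrec : forall n, (0 < n)%N -> (1 + \sum_(1 <= k < n.+1) m k) * m n = 1)
  (hsupp : mu `[0%R, 1%R]%classic = 1%E)
  (hmom : forall n, (\int[mu]_(t in `[0%R, 1%R]%classic) ((t : R) ^+ n)%:E = (m n)%:E)%E) :
  let f := f_mu mu in
  ((forall s, 0 < s -> 0 < f s)
   /\ f 1 = 1
   /\ convex_function (E := R^o) `]0, +oo[%classic (fun s => ln (1 / f s))
   /\ (forall s, 0 < s -> f s = f (s + 1) - 1 / f (s + 1)))
  /\ (forall ft : R -> R,
        (forall s, 0 < s -> 0 < ft s) ->
        ft 1 = 1 ->
        convex_function (E := R^o) `]0, +oo[%classic (fun s => ln (1 / ft s)) ->
        (forall s, 0 < s -> ft s = ft (s + 1) - 1 / ft (s + 1)) ->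
        (forall s, 0 < s -> ft s = f s)
        /\ (forall s, 0 < s -> s <= 1 ->
              (fun n => iter n (@psi R)
                 ((1 / m n.-1) * powR (m n.-1 / m n) s)) @ \oo --> ft s))
  /\ (forall s, 0 < s -> s <= 1 ->
        (fun n => iter n (@psi R)
           ((1 / m n.-1) * powR (m n.-1 / m n) s)) @ \oo --> f s).
Proof.
move=> f.
have x_0 : (m 0%N)^-1 = 1 by rewrite hm0 invr1.
have x_gt0 n : 0 < (m n)^-1 by rewrite invr_gt0.
have x_rec := m_inv_rec hm0 hmpos hmrec.
have f_gt0 : forall s, 0 < s -> 0 < f s by exact: f_mu_gt0 hm0 hmpos hmrec hsupp hmom.
have f_1 : f 1 = 1 by rewrite /f (f_mu_nat hm0 hmpos hmrec hsupp hmom 0).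
have f_convex : convex_function (E := R^o) `]0, +oo[%classic (fun s => ln (1 / f s)).
  apply/(convex_ln_inv f_gt0) => l a b l01 a0 b0.
  have fab := f_mu_concave hm0 hmpos hmrec hsupp hmom l01 a0 b0.
  have fab0 := i01_comb_gt0 l01 (f_gt0 a a0) (f_gt0 b b0).
  apply: (@le_trans _ _ (ln (l * f a + (1 - l) * f b))).
    have [i <-] := i01_exists l01.
    by have := concave_ln i (f_gt0 a a0) (f_gt0 b b0); rewrite !convRE.
  by rewrite ler_ln ?posrE// f_gt0// i01_comb_gt0.
have f_psi : forall s, 0 < s -> f s = psi (f (s + 1)).
  by move=> s; exact: f_mu_psi hm0 hmpos hmrec hsupp hmom _.
have limit (g : R -> R) s : (forall s, 0 < s -> 0 < g s) -> g 1 = 1 ->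
    convex_function (E := R^o) `]0, +oo[%classic (fun s => ln (1 / g s)) ->
    (forall s, 0 < s -> g s = psi (g (s + 1))) -> 0 < s -> s <= 1 ->
    (fun n => iter n (@psi R) ((1 / m n.-1) * powR (m n.-1 / m n) s)) @ \oo --> g s.
  move=> g_gt0 g_1 g_convex g_psi s0 s1.
  have g_conc := (convex_ln_inv g_gt0).1 g_convex.
  have s01 : 0 < s <= 1 by rewrite s0.
  have := iter_psi_cvg x_0 x_gt0 x_rec g_gt0 g_1 g_conc g_psi s01.
  by under eq_fun do rewrite invrK (mulrC (m _)^-1 (m _)) -div1r.
split; [by []|split]; last by move=> s; exact: limit.
move=> g g_gt0 g_1 g_convex g_psi; split; last by move=> s; exact: limit.
(* The common limit settles ]0, 1]. Injectivity of [psi] then carries equality from s - 1 to s, by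
   induction on an integer bound for [s]. *)
suff gf n s : 0 < s <= n.+1%:R -> g s = f s.
  move=> s s0; apply: (gf (Num.Def.trunc s)).
  by rewrite s0 ltW// truncnS_gt.
elim: n s => [|n IH] s /andP[s0 sn].
  exact: (cvg_unique _ (limit g s g_gt0 g_1 g_convex g_psi s0 sn)
                       (limit f s f_gt0 f_1 f_convex f_psi s0 sn)).
have [s1|s1] := leP s 1; first by apply: IH; rewrite s0 (le_trans s1)// ler1n.
have s10 : 0 < s - 1 by rewrite subr_gt0.
apply: psi_inj; [exact: g_gt0|exact: f_gt0|].
have := g_psi _ s10; have := f_psi _ s10; rewrite subrK /psi => <- <-.
by apply: IH; rewrite s10 lerBlDr natr1.
Qed.
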